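(* Fix $k\in\mathbb{N}$ and let $\mathcal{D}_k$ be the class of $k$-degenerate graphs. Then for every fixed forest $T$, $$C(T,\mathcal{D}_k,n) \in \Theta(n^{\alpha_k(T)}) \quad (n\to\infty).$$
   Context: All graphs are finite, simple and undirected. A graph is $k$-degenerate if every subgraph has minimum degree at most $k$. For graphs $H,G$, $C(H,G)$ denotes the number of subgraphs of $G$ isomorphic to $H$ (''copies'' of $H$). For a graph class $\mathcal{G}$, $C(H,\mathcal{G},n):=\max\{C(H,G): G\in\mathcal{G},\ |V(G)|=n\}$. For a graph $G$ and $s\in\mathbb{N}_0$, $\alpha_s(G)$ is the maximum size of a stable (independent) set in the subgraph of $G$ induced by the vertices of degree at most $s$ in $G$. The notation $\Theta(n^{a})$ means bounded above and below by positive constant multiples of $n^a$ (constants depending on $T$ and $k$) for all sufficiently large $n$. *)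

(* Defs.v *)
From HB Require Import structures.
From mathcomp Require Import all_boot.

Set Implicit Arguments.
Unset Strict Implicit.
Unset Printing Implicit Defensive.

(* A finite simple undirected graph is a set of vertices taken in an ambient
   finType, with a set of two-element subsets of it as edges.  The vertex set
   need not exhaust the ambient type, so that a graph and its subgraphs have
   the same Rocq type. *)

Definition is_graph (V : finType) (p : {set V} * {set {set V}}) : bool :=
  [forall e in p.2, (#|e| == 2) && (e \subset p.1)].

Record graph (V : finType) : predArgType := Graph {
  graph_val : {set V} * {set {set V}};
  _ : is_graph graph_val
}.

HB.instance Definition _ (V : finType) := [isSub for @graph_val V].
HB.instance Definition _ (V : finType) := [Finite of graph V by <:].

Definition vertices (V : finType) (G : graph V) : {set V} := (graph_val G).1.

Definition edges (V : finType) (G : graph V) : {set {set V}} :=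
  (graph_val G).2.

Definition adj (V : finType) (G : graph V) : rel V :=
  fun x y => [set x; y] \in edges G.

Definition degree (V : finType) (G : graph V) (v : V) : nat :=
  #|[set e in edges G | v \in e]|.

Definition subgraph (V : finType) (S G : graph V) : bool :=
  (vertices S \subset vertices G) && (edges S \subset edges G).

Lemma induced_subproof (V : finType) (G : graph V) (A : {set V}) :
  is_graph (vertices G :&: A, [set e in edges G | e \subset A]).
Proof.
apply/forall_inP => e /=; rewrite inE => /andP[eG eA].
have /forall_inP /(_ e eG) /andP[-> eV] := valP G.
by rewrite subsetI eV eA.
Qed.

Definition induced (V : finType) (G : graph V) (A : {set V}) : graph V :=
  Graph (induced_subproof G A).

(* The bijection is between the vertex sets, not between the ambient types. *)
Definition isomorphic (V W : finType) (G : graph V) (H : graph W) : bool :=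
  [exists f : {ffun {x : V | x \in vertices G} -> {y : W | y \in vertices H}},
    [&& injectiveb f,
        [forall y, y \in codom f] &
        [forall x, forall x', adj G (val x) (val x') ==
                              adj H (val (f x)) (val (f x'))]]].

(* A forest is a graph without cycles; ucycle also accepts the degenerate
   closed walks on fewer than three vertices. *)
Definition forest (V : finType) (G : graph V) : Prop :=
  forall c : seq V, 3 <= size c -> ~ ucycle (adj G) c.

Definition copies (W V : finType) (H : graph W) (G : graph V) : nat :=
  #|[set S : graph V | subgraph S G && isomorphic S H]|.

(* Graph classes are meant to be closed under isomorphism. *)
Definition graph_class := forall V : finType, pred (graph V).

(* By closure under isomorphism, n-vertex graphs may be taken on 'I_n. *)
Definition max_copies (W : finType) (H : graph W) (C : graph_class) (n : nat)
    : nat :=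
  \max_(G : graph 'I_n | (vertices G == setT) && C 'I_n G) copies H G.

(* The graph without vertices has no minimum degree, hence is left out. *)
Definition degenerate (k : nat) : graph_class := fun V G =>
  [forall S : graph V, subgraph S G && (vertices S != set0) ==>
    [exists v in vertices S, degree S v <= k]].

Definition stable (V : finType) (G : graph V) (A : {set V}) : bool :=
  (A \subset vertices G) && [forall x in A, forall y in A, ~~ adj G x y].

Definition independence_number (V : finType) (G : graph V) : nat :=
  \max_(A : {set V} | stable G A) #|A|.

(* Degrees are taken in G itself, not in the induced subgraph. *)
Definition alpha (s : nat) (V : finType) (G : graph V) : nat :=
  independence_number (induced G [set v in vertices G | degree G v <= s]).

(* Main.v *)
(* Upper bound: orient the edges of a k-degenerate graph G along a degeneracy
   order, so that all out-degrees are at most k.  The sources of the orientation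
   induced on a copy of T are pairwise non-adjacent and have degree at most k,
   so there are at most alpha_k(T) of them; once their images are chosen, every
   other vertex is reached along out-edges, with at most k choices each.
   Lower bound: clone each vertex of a largest stable set of vertices of degree
   at most k about n / |T| times.  Clones have degree at most k and the other
   vertices span a forest, so the result is k-degenerate; picking one clone of
   each vertex independently gives order n^alpha_k(T) copies of T. *)
Require Import Defs.
From mathcomp Require Import all_boot.

Set Implicit Arguments.
Unset Strict Implicit.
Unset Printing Implicit Defensive.

(** * Adjacency, degrees, and the cycle forced by minimum degree two *)

Lemma imset_set2 (aT rT : finType) (f : aT -> rT) x y :
  f @: [set x; y] = [set f x; f y].
Proof. by rewrite imsetU1 imset_set1. Qed.

Lemma edgeP (V : finType) (G : graph V) e :
  e \in edges G -> #|e| == 2 /\ e \subset vertices G.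
Proof. by move/forall_inP: (valP G) => h /h /andP[]. Qed.

Lemma adjC (V : finType) (G : graph V) : symmetric (adj G).
Proof. by move=> x y; rewrite /adj setUC. Qed.

Lemma adj_irr (V : finType) (G : graph V) x : adj G x x = false.
Proof. by apply/negP => /edgeP[]; rewrite setUid cards1. Qed.

Lemma adj_vertices (V : finType) (G : graph V) x y :
  adj G x y -> (x \in vertices G) && (y \in vertices G).
Proof. by case/edgeP=> _; rewrite subUset !sub1set. Qed.

Lemma edge_adj (V : finType) (G : graph V) e :
  e \in edges G -> exists x y, e = [set x; y] /\ adj G x y.
Proof.
move=> eG; have [/cards2P[x [y [_ ee]]] _] := edgeP eG.
by exists x, y; rewrite /adj -ee.
Qed.

Lemma degreeE (V : finType) (G : graph V) x :
  degree G x = #|[set y | adj G x y]|.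
Proof.
rewrite /degree.
have -> : [set e in edges G | x \in e] =
    [set [set x; y] | y in [set y | adj G x y]].
  apply/setP=> e; rewrite inE; apply/andP/imsetP.
    case=> /edge_adj[a [b [-> ab]]]; rewrite !inE => /orP[]/eqP->.
      by exists b; rewrite ?inE.
    by exists a; rewrite ?inE 1?adjC // setUC.
  by case=> y; rewrite inE => xy ->; rewrite !inE eqxx.
apply: card_in_imset => y z; rewrite !inE => xy xz eqyz.
have : y \in [set x; z] by rewrite -eqyz !inE eqxx orbT.
rewrite !inE => /orP[]/eqP // exy.
by move: xy; rewrite exy adj_irr.
Qed.

Lemma subgraph_adj (V : finType) (S G : graph V) x y :
  subgraph S G -> adj S x y -> adj G x y.
Proof. by case/andP=> _ /subsetP; apply. Qed.

Lemma subgraph_degree (V : finType) (S G : graph V) x :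
  subgraph S G -> degree S x <= degree G x.
Proof.
move=> SG; rewrite !degreeE; apply/subset_leq_card/subsetP=> y.
by rewrite !inE; apply: subgraph_adj.
Qed.

Lemma adj_induced (V : finType) (G : graph V) A x y :
  adj (induced G A) x y = [&& adj G x y, x \in A & y \in A].
Proof. by rewrite /adj /edges /= inE subUset !sub1set. Qed.

(* A longest path closes up: its first vertex has a second neighbour, which
   by maximality lies on the path. *)
Lemma cycle_of_degree (V : finType) (S : graph V) :
  vertices S != set0 -> (forall x, x \in vertices S -> 1 < degree S x) ->
  exists2 c : seq V, 2 < size c & ucycle (adj S) c.
Proof.
case/set0Pn=> x0 x0S deg.
pose P n := [exists t : n.-tuple V,
  [exists x in vertices S, path (adj S) x t && uniq (x :: t)]].
have P0 : exists n, P n.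
  by exists 0; apply/existsP; exists [tuple]; apply/exists_inP; exists x0.
have Pmax n : P n -> n <= #|V|.
  case/existsP=> t /exists_inP[x _ /andP[_ /=/andP[_ ut]]].
  by rewrite -[n](size_tuple t) -(card_uniqP ut) max_card.
case: (ex_maxnP P0 Pmax) => n /existsP[t /exists_inP[x xS /andP[pt ut]]] maxn.
have nbr y : adj S x y -> y \in tval t.
  move=> xy; apply/contraT=> yt.
  suff : P n.+1 by move/maxn; rewrite ltnn.
  apply/existsP; exists [tuple of x :: t]; apply/exists_inP; exists y.
    by case/andP: (adj_vertices xy).
  rewrite /= adjC xy pt /=; move: ut => /= ->; rewrite andbT inE negb_or yt.
  by rewrite andbT; apply: contraTneq xy => ->; rewrite adj_irr.
(* Two neighbours leave one besides the first vertex of [t]. For empty [t] the default [x] is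
   harmless: [nbr] then leaves no place for any neighbour. *)
have : 0 < #|[set y | adj S x y] :\ head x t|.
  have := deg x xS; rewrite degreeE (cardsD1 (head x t)).
  by case: (_ \in _); rewrite ?add1n ?add0n //; apply: ltnW.
case/card_gt0P=> y; rewrite !inE => /andP[nyh xy].
move: (nbr y xy) pt ut nyh; case/splitPr=> -[|z p1] p2.
  by rewrite /= eqxx.
(* As [y] is not the head of [t], some [z] precedes it on [t]; cutting the path at [y] thus leaves
   at least three vertices. *)
move=> pt ut _; exists (x :: rcons (z :: p1) y); first by rewrite /= size_rcons.
move: pt ut; rewrite -cat_rcons cat_path => /andP[pt _].
rewrite -cat_cons cat_uniq => /andP[ut _].
by rewrite /ucycle ut andbT [cycle _ _]rcons_path pt last_rcons adjC xy.
Qed.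

(** * Blow-ups: cloning the vertices of a graph *)

Section Blowup.
Variables (W V : finType) (T : graph W) (phi : V -> option W).

(** The vertices over [w] are the clones of [w]; those over [None] are isolated and fill up the
    vertex set, which is all of [V]. *)
Definition blowup_adj x y : bool :=
  if (phi x, phi y) is (Some w, Some w') then adj T w w' else false.

Lemma blowup_subproof : is_graph ([set: V],
  [set [set p.1; p.2] | p in [set p : V * V | blowup_adj p.1 p.2]]).
Proof.
apply/forall_inP=> e /= /imsetP[[x y]]; rewrite inE /blowup_adj /= => xy ->.
rewrite subsetT andbT cards2; suff -> : x != y by [].
by apply: contraTneq xy => ->; case: (phi y) => // w; rewrite adj_irr.
Qed.

Definition blowup : graph V := Graph blowup_subproof.

Lemma adj_blowup x y : adj blowup x y = blowup_adj x y.
Proof.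
have sym a b : blowup_adj a b = blowup_adj b a.
  by rewrite /blowup_adj; case: (phi a) (phi b) => [w|] [w'|] //; apply: adjC.
have irr a : blowup_adj a a = false.
  by rewrite /blowup_adj; case: (phi a) => // w; apply: adj_irr.
apply/imsetP/idP; last by move=> xy; exists (x, y); rewrite ?inE.
case=> -[a b]; rewrite inE /= => ab eqe.
have /orP[/eqP ex|/eqP ex] : (x == a) || (x == b).
  by move/setP: eqe => /(_ x); rewrite !inE eqxx /= => <-.
  have : b \in [set x; y] by rewrite eqe !inE eqxx orbT.
  rewrite !inE => /orP[]/eqP eb; last by rewrite ex -eb.
  by move: ab; rewrite eb ex irr.
have : a \in [set x; y] by rewrite eqe !inE eqxx.
rewrite !inE => /orP[]/eqP ea; last by rewrite ex -ea sym.
by move: ab; rewrite ea ex irr.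
Qed.

(** A clone of a member of [A] has degree at most [k], since its neighbours lie over vertices
    outside [A], which have at most one clone each. A subgraph without such clones and without
    vertices over [None] is mapped injectively into [T] by [phi]; minimum degree above 1 would give
    a cycle there and hence one in the forest [T]. *)
Lemma blowup_degenerate k (A : {set W}) : 0 < k -> forest T ->
  (forall w, w \in A -> degree T w <= k) ->
  (forall w w', w \in A -> w' \in A -> ~~ adj T w w') ->
  (forall x y w, w \notin A -> phi x = Some w -> phi y = Some w -> x = y) ->
  degenerate k blowup.
Proof.
move=> k_gt0 forT degA stA injA.
apply/forallP=> S; apply/implyP=> /andP[SG S0].
(* The value [true] at [None] puts the isolated vertices into the low-degree case. *)
pose inA x := if phi x is Some w then w \in A else true.
have [/existsP[x /andP[xS xA]]|/existsPn notA] :=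
    boolP [exists x, (x \in vertices S) && inA x].
  apply/exists_inP; exists x => //; apply: (leq_trans (subgraph_degree x SG)).
  rewrite degreeE; move: xA; rewrite /inA.
  case ex: (phi x) => [w|] wA; last first.
    rewrite (_ : [set y | _] = set0) ?cards0 //.
    by apply/setP=> y; rewrite !inE adj_blowup /blowup_adj ex.
  apply: leq_trans (degA w wA); rewrite degreeE.
  pose N := [set y | adj blowup x y].
  have NP y : y \in N -> exists2 w', phi y = Some w' & adj T w w'.
    rewrite inE adj_blowup /blowup_adj ex.
    by case: (phi y) => // w' ww'; exists w'.
  have phi_inj : {in N &, injective phi}.
    move=> y z /NP[w' ey ww'] _ eyz; apply: (injA y z w') => //.
      by apply/negP=> w'A; move: (stA w w' wA w'A); rewrite ww'.
    by rewrite -eyz.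
  have some_inj : injective (@Some W) by move=> ? ? [].
rewrite -(card_in_imset phi_inj) -(card_imset _ some_inj).
  apply/subset_leq_card/subsetP=> o /imsetP[y /NP[w' -> ww'] ->].
  by apply: imset_f; rewrite inE.
(* Degree 1 is good enough because [k] is positive. *)
have [/exists_inP[x xS xd]|/exists_inPn large] :=
    boolP [exists x in vertices S, degree S x <= 1].
  by apply/exists_inP; exists x => //; apply: leq_trans xd _.
have [x xS|c c3 /andP[cyc unc]] := cycle_of_degree S0 (_ : forall x, _ -> _).
  by rewrite ltnNge large.
have [w0 _] : exists w : W, true.
  case/set0Pn: S0 => x xS; move: (notA x); rewrite xS /inA.
  by case: (phi x) => // w; exists w.
pose f x := odflt w0 (phi x).
have phif x : x \in vertices S -> phi x = Some (f x) /\ f x \notin A.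
  by move=> xS; move: (notA x); rewrite xS /inA /f; case: (phi x).
have cS : {subset c <= vertices S}.
  move=> x xc; have := next_cycle cyc xc => xy.
  by case/andP: (adj_vertices xy).
exfalso; apply: (forT (map f c)); first by rewrite size_map.
rewrite /ucycle map_inj_in_uniq ?unc ?andbT; last first.
  move=> x y /cS/phif[ex xA] /cS/phif[ey _] exy.
  by apply: (injA x y (f x)) => //; rewrite exy.
apply: (homo_cycle_in (P := mem (vertices S))) cyc => [x y xS yS xy|].
  have := subgraph_adj SG xy; rewrite adj_blowup /blowup_adj.
  by have [[-> _] [-> _]] := (phif x xS, phif y yS).
exact/allP.
Qed.

(** Each [e i] is a section of [phi], so it carries [T] onto a copy. Since [phi] tells which vertex
    of [T] a vertex of the copy stands for, the vertex set alone determines [e i] on [vertices T],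
    hence [i]. *)
Lemma sections_leq_copies (I : finType) (e : I -> W -> V) :
  (forall i w, phi (e i w) = Some w) ->
  (forall i j, {in vertices T, e i =1 e j} -> i = j) ->
  #|I| <= copies T blowup.
Proof.
move=> eK e_inj.
have inj_e i : injective (e i).
  by move=> w w' eqw; have := eK i w; rewrite eqw eK => -[].
have graphP i :
    is_graph (e i @: vertices T, [set e i @: (d : {set W}) | d in edges T]).
  apply/forall_inP=> d /= /imsetP[d' /edgeP[d2 dV] ->].
  by rewrite card_imset // d2 imsetS.
pose S i := Graph (graphP i).
have S_inj : injective S.
  move=> i j /(congr1 (fun X => vertices X)); rewrite /vertices /= => eqV.
  apply: e_inj => w wT; have : e i w \in e j @: vertices T.
    by rewrite -eqV imset_f.
  by case/imsetP=> w' _ ew; have := eK i w; rewrite ew eK => -[->].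
rewrite /copies -(card_codom S_inj); apply/subset_leq_card/subsetP=> ?.
case/codomP=> i ->; rewrite inE; apply/andP; split.
  apply/andP; split; first exact: subsetT.
  apply/subsetP=> _ /imsetP[d /edge_adj[x [y [-> xy]]] ->].
  by rewrite imset_set2 -[_ \in _]/(adj _ _ _) adj_blowup /blowup_adj !eK.
have adjS x y : adj (S i) (e i x) (e i y) = adj T x y.
  by rewrite /adj -imset_set2 /edges /= mem_imset //; apply: imset_inj.
have phiP (x : {x : V | x \in vertices (S i)}) :
    exists2 w, w \in vertices T & val x == e i w.
  by case: x => x /= /imsetP[w wT ->]; exists w.
pose f (x : {x : V | x \in vertices (S i)}) : {w : W | w \in vertices T} :=
  exist _ (s2val (sig2W (phiP x))) (s2valP (sig2W (phiP x))).
have fE x : val x = e i (val (f x)).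
  by apply/eqP/(s2valP' (sig2W (phiP x))).
apply/existsP; exists (finfun f); apply/and3P; split.
- apply/injectiveP=> x y; rewrite !ffunE => eqf; apply/val_inj.
  by rewrite !fE eqf.
- apply/forallP=> -[w wT]; apply/codomP.
  have ewS : e i w \in vertices (S i) by apply: imset_f.
  exists (Sub (e i w) ewS); rewrite ffunE; apply/val_inj/(inj_e i).
  exact: fE (Sub (e i w) ewS).
- by apply/forallP=> x; apply/forallP=> y; rewrite !ffunE !fE adjS.
Qed.
End Blowup.

(** * Embeddings and degeneracy orders *)

(** The inverse of the isomorphism, extended arbitrarily to all of [W]. A copy is thereby recovered
    from a plain finite function, which is what the encoding of copies has to determine. *)
Lemma isomorphic_embedding (W V : finType) (T : graph W) (S : graph V)
    (v0 : V) : isomorphic S T ->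
  exists2 f : {ffun W -> V}, {in vertices T &, injective f} &
    graph_val S = (f @: vertices T, [set f @: (d : {set W}) | d in edges T]).
Proof.
case/existsP=> g /and3P[/injectiveP g_inj /forallP g_surj /forallP g_adj].
(* The implication makes a witness available off [vertices T] too, so that [xchoose] yields a total
   function. *)
have invP w : exists x, (w \in vertices T) ==>
    [exists x' : {x : V | x \in vertices S},
       (val x' == x) && (val (g x') == w)].
  have [wT|] := boolP (w \in vertices T); last by exists v0.
  have /codomP[x' gx'] := g_surj (Sub w wT); exists (val x').
  by apply/existsP; exists x'; rewrite -gx' !eqxx.
pose f := [ffun w => xchoose (invP w)].
have fP w : w \in vertices T -> exists2 x', val x' = f w & val (g x') = w.
  move=> wT; have /implyP/(_ wT)/existsP[x' /andP[/eqP ex /eqP ew]] :=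
    xchooseP (invP w).
  by exists x'; rewrite ?ffunE.
have fg x : f (val (g x)) = val x.
  by have [x' <- /val_inj/g_inj ->] := fP _ (valP (g x)).
exists f => [w w' /fP[x <- <-] /fP[y <- <-] /val_inj -> //|].
rewrite [LHS]surjective_pairing; congr pair.
  apply/setP=> x; apply/idP/imsetP=> [xS|[w /fP[x' <- _] ->]]; last exact: valP.
  by exists (val (g (Sub x xS))); rewrite ?fg //; apply: valP.
have adjE x y : adj S (val x) (val y) = adj T (val (g x)) (val (g y)).
  by have /forallP/(_ y)/eqP := g_adj x.
apply/setP=> d; apply/idP/imsetP=> [|[d' /edge_adj[x [y [-> xy]]] ->]].
  case/edge_adj=> x [y [-> xy]]; have /andP[xS yS] := adj_vertices xy.
  exists [set val (g (Sub x xS)); val (g (Sub y yS))].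
    by rewrite -[_ \in _]/(adj _ _ _) -adjE.
  by rewrite imset_set2 !fg.
rewrite imset_set2 -[_ \in _]/(adj S _ _).
have /andP[/fP[x' ex gx] /fP[y' ey gy]] := adj_vertices xy.
by rewrite -ex -ey adjE gx gy.
Qed.

(** Induction on [#|A|]: a vertex of degree at most [k] in the subgraph induced on [A] is put on top
    of an order of the rest. The lower neighbours are the out-neighbours of the orientation. *)
Lemma degenerate_order k (V : finType) (G : graph V) (A : {set V}) :
  degenerate k G -> A \subset vertices G ->
  exists2 r : V -> nat, {in A &, injective r} &
    forall x, x \in A -> #|[set y in A | adj G x y & r y < r x]| <= k.
Proof.
move=> degG; have [n] := ubnP #|A|; elim: n A => // n IHn A leAn AG.
have [->|A0] := eqVneq A set0.
  by exists (fun=> 0) => x; rewrite inE.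
have [x xA degx] : exists2 x, x \in A & degree (induced G A) x <= k.
  have /forallP/(_ (induced G A))/implyP := degG.
  rewrite /subgraph /vertices /edges /= (setIidPr AG) AG A0 andbT.
  have -> : [set e in edges G | e \subset A] \subset edges G.
    by apply/subsetP=> e; rewrite inE => /andP[].
  by move=> /(_ isT)/exists_inP.
have [r r_inj r_deg] : exists2 r : V -> nat, {in A :\ x &, injective r} &
    forall z, z \in A :\ x -> #|[set y in A :\ x | adj G z y & r y < r z]| <= k.
  apply: IHn; last by apply: subset_trans AG; apply: subsetDl.
  by move: leAn; rewrite (cardsD1 x) xA.
(* A rank above all others: placed there, [x] is a lower neighbour of no other vertex. *)
pose m := (\max_y r y).+1.
have r_lt y : r y < m by rewrite ltnS; apply: leq_bigmax.
exists (fun y => if y == x then m else r y).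
  move=> y z yA zA /=; case: eqP => [->|/eqP yx]; case: eqP => [->|/eqP zx] //.
  - by move=> mr; move: (r_lt z); rewrite -mr ltnn.
  - by move=> rm; move: (r_lt y); rewrite rm ltnn.
  - by apply: r_inj; rewrite !inE ?yx ?zx.
move=> z zA; case: eqP => [->|/eqP zx].
  apply: leq_trans degx; rewrite degreeE; apply/subset_leq_card/subsetP=> y.
  by rewrite !inE adj_induced => /and3P[yA -> _]; rewrite xA yA.
apply: leq_trans (r_deg z _); last by rewrite !inE zx.
apply/subset_leq_card/subsetP=> y; rewrite !inE => /and3P[-> ->].
by case: eqP => // _; rewrite ltnNge ltnW.
Qed.

(** * Stable sets of vertices of low degree *)

(** With [alpha_stable], this replaces [alpha] by stable sets of [T] itself. The present half bounds
    the number of sources; the other supplies the vertices to clone. *)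
Lemma stable_alpha k (W : finType) (T : graph W) (A : {set W}) :
  A \subset vertices T -> (forall w, w \in A -> degree T w <= k) ->
  (forall w w', w \in A -> w' \in A -> ~~ adj T w w') -> #|A| <= alpha k T.
Proof.
move=> /subsetP AT degA stA; rewrite /alpha /independence_number.
apply: (bigmax_sup A) => //.
apply/andP; split.
  by apply/subsetP=> w wA; rewrite !inE (AT w wA) degA.
apply/forall_inP=> w wA; apply/forall_inP=> w' w'A.
by rewrite adj_induced negb_and stA.
Qed.

Lemma alpha_stable k (W : finType) (T : graph W) : exists A : {set W},
  [/\ A \subset vertices T, forall w, w \in A -> degree T w <= k,
      forall w w', w \in A -> w' \in A -> ~~ adj T w w' & #|A| = alpha k T].
Proof.
rewrite /alpha /independence_number.
set L := induced _ _.
(* Some stable set must exist for the maximum to be attained. *)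
have st0 : stable L set0.
  by rewrite /stable sub0set /=; apply/forall_inP=> w; rewrite inE.
have [|A /andP[/subsetP AL /forall_inP stA] ->] :=
    @eq_bigmax_cond _ (stable L) (fun A => #|A|).
  by apply/card_gt0P; exists set0.
have {}AL w : w \in A -> (w \in vertices T) && (degree T w <= k).
  by move/AL; rewrite !inE => /andP[_].
exists A; split=> //.
- by apply/subsetP=> w /AL/andP[].
- by move=> w /AL/andP[].
move=> w w' wA w'A; have /forall_inP/(_ w' w'A) := stA w wA.
rewrite adj_induced !inE.
by case/andP: (AL w wA) => -> ->; case/andP: (AL w' w'A) => -> ->;
  rewrite !andbT.
Qed.

(** * The upper bound *)

(* The copy is encoded by the images of its sources and, for every other vertex,
   an in-neighbour and the number of the out-edge followed from there. *)
Lemma copies_degenerate_leq k (W V : finType) (T : graph W) (G : graph V) :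
  0 < #|V| -> degenerate k G ->
  copies T G <= (1 + #|W| * k) ^ #|W| * #|V| ^ alpha k T.
Proof.
case/card_gt0P=> v0 _ degG.
have [r r_inj r_deg] := degenerate_order degG (subxx _).
pose out x := enum [set y in vertices G | adj G x y & r y < r x].
have size_out x y : y \in out x -> index y (out x) < k.
  move=> yx; apply: (@leq_trans (size (out x))); first by rewrite index_mem.
  move: yx; rewrite mem_enum inE => /and3P[_ /adj_vertices/andP[xG _] _].
  by rewrite -cardE r_deg.
pose emb (S : graph V) (f : {ffun W -> V}) :=
  (graph_val S == (f @: vertices T, [set f @: (d : {set W}) | d in edges T])).
pose X := [set S : graph V | subgraph S G && isomorphic S T].
have embP S : exists f, (S \in X) ==>
    emb S f && [forall x in vertices T, forall y in vertices T,
                  (f x == f y) ==> (x == y)].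
  have [|_] := boolP (S \in X); last by exists [ffun=> v0].
  rewrite inE => /andP[_ /(isomorphic_embedding v0)[f f_inj fS]]; exists f.
  rewrite /emb fS eqxx /=; apply/forall_inP=> x xT; apply/forall_inP=> y yT.
  by apply/implyP=> /eqP/f_inj ->.
pose f S := xchoose (embP S).
have fP S : S \in X -> emb S (f S) /\ {in vertices T &, injective (f S)}.
  move=> SX; have /implyP/(_ SX)/andP[eS /forall_inP inj] := xchooseP (embP S).
  split=> // x y xT yT /eqP exy.
  by have /forall_inP/(_ y yT)/implyP/(_ exy)/eqP := inj x xT.
have f_adj S : S \in X -> forall w w', adj T w w' -> adj G (f S w) (f S w').
  move=> SX w w' ww'; have [/eqP eS _] := fP S SX.
  move: SX; rewrite inE => /andP[SG _]; apply: subgraph_adj SG _.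
  by rewrite /adj /edges eS -imset_set2 imset_f.
(* Edges point to the smaller rank; [par] picks an in-neighbour, and the vertices of [T] without one
   are the sources. *)
pose par S w := [pick w' | adj T w' w && (r (f S w) < r (f S w'))].
pose src S := [set w in vertices T | par S w == None].
have r_neq S : S \in X -> forall w w', adj T w w' -> r (f S w) != r (f S w').
  move=> SX w w' ww'.
  have /andP[fwG fw'G] := adj_vertices (f_adj S SX w w' ww').
  apply/eqP=> /(r_inj _ _ fwG fw'G) eqf.
  by have := f_adj S SX w w' ww'; rewrite eqf adj_irr.
have in_out S : S \in X -> forall w w', par S w = Some w' ->
    f S w \in out (f S w').
  rewrite /par => SX w w'; case: pickP => // ? /andP[w'w rw] [<-].
  have adjG := f_adj S SX _ _ w'w.
  by rewrite mem_enum inE adjG rw !andbT; case/andP: (adj_vertices adjG).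
(* All neighbours of a source have smaller rank, so its degree is at most the out-degree of its
   image; two adjacent sources would each outrank the other. *)
have card_src S : S \in X -> #|src S| <= alpha k T.
  move=> SX; have [_ inj] := fP S SX.
  have srcP w : w \in src S -> forall w', adj T w w' -> r (f S w') < r (f S w).
    rewrite inE /par => /andP[_]; case: pickP => // srcw _ w' ww'.
    have := srcw w'; rewrite adjC ww' /= => /negbT; rewrite -leqNgt leq_eqVlt.
    by rewrite (negbTE (r_neq S SX w' w _)) // adjC.
  apply: stable_alpha.
  - by apply/subsetP=> w; rewrite inE => /andP[].
  - move=> w wS; have wT : w \in vertices T by move: wS; rewrite inE => /andP[].
    rewrite degreeE; have [N0|[w0]] := set_0Vmem [set w' | adj T w w'].
      by rewrite N0 cards0.
    rewrite inE => ww0; have /andP[fwG _] := adj_vertices (f_adj S SX _ _ ww0).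
    have injN : {in [set w' | adj T w w'] &, injective (f S)}.
      move=> x y; rewrite !inE => wx wy; apply: inj.
        by case/andP: (adj_vertices wx).
      by case/andP: (adj_vertices wy).
    rewrite -(card_in_imset injN); apply: leq_trans (r_deg _ fwG).
    apply/subset_leq_card/subsetP=> ? /imsetP[w']; rewrite inE => ww' ->.
    have adjG := f_adj S SX _ _ ww'; rewrite inE adjG srcP // !andbT.
    by case/andP: (adj_vertices adjG).
  - move=> w w' wS w'S; apply/negP=> ww'.
    have := srcP w wS w' ww'; have := srcP w' w'S w; rewrite adjC => /(_ ww').
    by move=> lt1 /(ltn_trans lt1); rewrite ltnn.
pose slot x y : option 'I_k := insub (index y (out x)).
(* The first component is [None] at sources and off [vertices T]. The list of images of the sources
   is padded with [v0] to length [alpha k T], long enough by [card_src]. *)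
pose code S : {ffun W -> option (W * 'I_k)} * {ffun 'I_(alpha k T) -> V} :=
  ([ffun w => if par S w is Some w' then
                omap (pair w') (slot (f S w') (f S w)) else None],
   [ffun i : 'I__ => nth v0 (map (f S) (enum (src S))) i]).
have code_par S : S \in X -> forall w,
    par S w = omap fst ((code S).1 w).
  move=> SX w; rewrite ffunE; case ew: (par S w) => [w'|] //.
  by rewrite /slot insubT //= size_out // in_out.
have code_slot S : S \in X -> forall w w', par S w = Some w' ->
  omap snd ((code S).1 w) = slot (f S w') (f S w).
  by move=> SX w w' ew; rewrite ffunE ew; case: (slot _ _).
have slot_inj x y y' : y \in out x -> y' \in out x ->
    slot x y = slot x y' -> y = y'.
  have slotE z : z \in out x -> oapp val k (slot x z) = index z (out x).
    by move=> zx; rewrite /slot; case: insubP => [i _ //|]; rewrite size_out.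
  move=> yx y'x /(congr1 (oapp val k)); rewrite !slotE // => eq_i.
  by rewrite -(nth_index v0 yx) eq_i nth_index.
have code_src S : S \in X -> forall w, w \in src S -> exists i,
    (code S).2 i = f S w /\ (i = index w (enum (src S)) :> nat).
  move=> SX w wS; have lt_i : index w (enum (src S)) < alpha k T.
    by apply: leq_trans (card_src S SX); rewrite cardE index_mem mem_enum.
  exists (Ordinal lt_i); rewrite ffunE (nth_map w) ?index_mem ?mem_enum //.
  by rewrite nth_index ?mem_enum.
have srcE S w : (w \in src S) = (w \in vertices T) && (par S w == None).
  by rewrite inE.
have parP S w w' : par S w = Some w' -> adj T w' w /\ r (f S w) < r (f S w').
  by rewrite /par; case: pickP => // ? /andP[? ?] [<-].
clearbody code slot src par f.
(* Decoding: the first component gives the parents, hence the sources and their positions; the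
   second gives the images of the sources, and the slots then give every other image from that of
   the parent. *)
have code_inj : {in X &, injective code}.
  move=> S S' SX S'X eqc.
  have eq_par w : par S w = par S' w.
    by rewrite (code_par S SX) eqc -(code_par S' S'X).
  have eq_src : src S = src S' by apply/setP=> w; rewrite !srcE eq_par.
  have eq_f w : w \in vertices T -> f S w = f S' w.
    (* The rank of [f S w] increases along parents, which bounds the
       recursion. *)
    have [n] := ubnP (\max_x r x - r (f S w)); elim: n w => // n IHn w le_n wT.
    case ew: (par S w) => [w'|]; last first.
      have wS : w \in src S by rewrite srcE wT ew.
      have [i [<- eq_i]] := code_src S SX w wS.
      rewrite eq_src in wS eq_i; have [i' [<- eq_i']] := code_src S' S'X w wS.
      by rewrite eqc (ord_inj (etrans eq_i (esym eq_i'))).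
    have ew' : par S' w = Some w' by rewrite -eq_par.
    have [w'w rw] := parP S w w' ew.
    have eq_w' : f S w' = f S' w'.
      apply: IHn; last by case/andP: (adj_vertices w'w).
      rewrite ltnS in le_n; apply: leq_trans (ltn_sub2l _ rw) le_n.
      exact: leq_trans rw (leq_bigmax _).
    have := code_slot S' S'X w w' ew'; rewrite -eqc (code_slot S SX w w' ew).
    have outS := in_out S SX w w' ew; have outS' := in_out S' S'X w w' ew'.
    by rewrite -eq_w' in outS' *; apply: slot_inj.
  have [/eqP eS _] := fP S SX; have [/eqP eS' _] := fP S' S'X.
  apply: val_inj; rewrite /= eS eS'; congr pair; first exact: eq_in_imset.
  apply: eq_in_imset => d /edgeP[_ /subsetP dT].
  by apply: eq_in_imset => w /dT; apply: eq_f.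
have := @leq_card_in _ _ code _ code_inj.
by rewrite card_prod !card_ffun card_option card_prod !card_ord add1n.
Qed.

Lemma max_copies_leq k (W : finType) (T : graph W) n : 0 < n ->
  max_copies T (degenerate k) n <= (1 + #|W| * k) ^ #|W| * n ^ alpha k T.
Proof.
move=> n_gt0; apply/bigmax_leqP=> G /andP[_ degG].
have := @copies_degenerate_leq k W 'I_n T G; rewrite card_ord; exact.
Qed.

(** * The lower bound *)

(* The vertices [c * #|W|.+1 + i] with [i < #|W|] are the clones of the [i]-th
   element of [W]; only members of the stable set have clones with [c > 0]. *)
Lemma max_copies_clones k (W : finType) (T : graph W) n :
  0 < k -> forest T -> #|W| < n ->
  (n %/ #|W|.+1) ^ alpha k T <= max_copies T (degenerate k) n.
Proof.
move=> k_gt0 forT ltn.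
have [A [/subsetP AT degA stA cardA]] := alpha_stable k T.
(* The successor keeps [M] positive even for empty [W]; the extra residue [#|W|] names no vertex and
   gives isolated vertices. *)
set M := #|W|.+1; pose nthW i : option W := nth None (map Some (enum W)) i.
have nthWK w : nthW (index w (enum W)) = Some w.
  by rewrite /nthW (nth_map w) ?nth_index ?index_mem ?mem_enum.
have ltM w : index w (enum W) < M.
  by rewrite ltnS cardE ltnW // index_mem mem_enum.
have nthW_inj i w : nthW i = Some w -> i = index w (enum W).
  rewrite /nthW; have [lt_i|] := ltnP i (size (enum W)); last first.
    by move=> le_i; rewrite nth_default // size_map.
  by rewrite (nth_map w) // => -[<-]; rewrite index_uniq ?enum_uniq.
pose phi (x : 'I_n) : option W :=
  if nthW (x %% M) is Some w then
    if (w \in A) || (x < M) then Some w else None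
  else None.
have phi_inj (x y : 'I_n) w :
    w \notin A -> phi x = Some w -> phi y = Some w -> x = y.
  have phiE (z : 'I_n) :
      w \notin A -> phi z = Some w -> z = index w (enum W) :> nat.
    rewrite /phi; case ez: (nthW _) => [w'|] // wA.
    case: ifP => // /orP[w'A [eqw]|zM [eqw]].
      by rewrite -eqw w'A in wA.
    by rewrite -(nthW_inj (z %% M)) ?modn_small // -eqw -ez modn_small.
  by move=> wA ex ey; apply: ord_inj; rewrite !phiE.
(* There are [n %/ M] complete blocks of length [M]; [h] chooses one for each member of [A], and all
   other vertices stay in block 0. *)
pose clone (h : {ffun {w : W | w \in A} -> 'I_(n %/ M)}) w : nat :=
  if insub w is Some a then h a * M + index w (enum W) else index w (enum W).
have clone_lt h w : clone h w < n.
  rewrite /clone; case: insubP => [a _ _|_].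
    apply: leq_trans (leq_trunc_div n M).
    apply: (@leq_trans ((h a).+1 * M)); last by rewrite leq_mul2r ltn_ord orbT.
    by rewrite mulSn addnC ltn_add2r.
  by apply: leq_ltn_trans ltn; rewrite cardE ltnW // index_mem mem_enum.
pose e h w : 'I_n := Ordinal (clone_lt h w).
have eK h w : phi (e h w) = Some w.
  rewrite /phi /= /clone; case: insubP => [a wA _|wA].
    by rewrite modnMDl modn_small // nthWK wA.
  by rewrite modn_small // nthWK ltM orbT.
have e_inj h h' : {in vertices T, e h =1 e h'} -> h = h'.
  move=> eqe; apply/ffunP=> a; apply: ord_inj.
  have /(congr1 val) := eqe _ (AT _ (valP a)); rewrite /= /clone valK.
  by move/addIn/eqP; rewrite eqn_mul2r => /eqP.
have := sections_leq_copies eK e_inj.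
rewrite card_ffun card_ord card_sig cardA => le_copies.
apply: leq_trans le_copies _; apply: leq_bigmax_cond.
rewrite eqxx; exact: (blowup_degenerate k_gt0 forT degA stA phi_inj).
Qed.

(** Rounding costs a factor of at most 2 in the base: the quotient [n %/ #|W|.+1] is positive, so
    the remainder is at most the quotient times [#|W|.+1]. *)
Lemma expn_leq_max_copies k (W : finType) (T : graph W) n :
  0 < k -> forest T -> #|W| < n ->
  n ^ alpha k T <=
    (2 * #|W|.+1) ^ alpha k T * max_copies T (degenerate k) n.
Proof.
move=> k_gt0 forT ltn.
apply: leq_trans (leq_mul (leqnn _) (max_copies_clones k_gt0 forT ltn)).
rewrite -expnMn; case: (alpha k T) => [|a]; rewrite ?expn0 // leq_exp2r //.
have q_gt0 : 0 < n %/ #|W|.+1 by rewrite divn_gt0.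
rewrite [leqLHS](divn_eq n #|W|.+1) -mulnA mul2n -addnn mulnC leq_add2l.
by apply: leq_trans (ltnW (ltn_pmod n (ltn0Sn _))) _; rewrite leq_pmulr.
Qed.

(* Passage to the asymptotic statement *)
(* Loaded only here: the lemmas on classical sets would shadow those on finite
   sets used above. *)
From mathcomp Require Import all_order all_algebra.
From mathcomp Require Import all_classical all_reals all_analysis.

Import numFieldNormedType.Exports.
Import Order.TTheory GRing.Theory Num.Theory.

Local Open Scope classical_set_scope.
Local Open Scope ring_scope.

Lemma bigTheta_natr (R : realType) (u v : nat -> nat) (a b N : nat) :
  (forall n, (N < n)%N -> (v n <= a * u n)%N) ->
  (forall n, (N < n)%N -> (u n <= b * v n)%N) ->
  (fun n => (u n)%:R : R^o) \is 'Theta_\oo (fun n => (v n)%:R : R^o).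
Proof.
move=> leva leub; rewrite qualifE; apply/asboolP.
(* Successors make both constants positive even if [a] or [b] is 0. *)
exists (a.+1%:R^-1, b.+1%:R); first by rewrite /= invr_gt0 !ltr0Sn.
exists N.+1 => //= n /= ltn; rewrite !normr_nat; split.
  rewrite mulrC ler_pdivrMr ?ltr0Sn // -natrM ler_nat mulnC.
  by apply: leq_trans (leva n ltn) _; rewrite leq_mul2r leqnSn orbT.
rewrite -natrM ler_nat; apply: leq_trans (leub n ltn) _.
by rewrite leq_mul2r leqnSn orbT.
Qed.

Theorem theorem1 (R : realType) (k : nat) (hk : (0 < k)%N)
    (W : finType) (T : graph W) (hT : forest T) :
  (fun n : nat => (max_copies T (degenerate k) n)%:R : R^o)
    \is 'Theta_\oo (fun n : nat => n%:R ^+ alpha k T : R^o).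
Proof.
have -> : (fun n : nat => n%:R ^+ alpha k T : R^o) =
    (fun n => (n ^ alpha k T)%N%:R).
  by apply/funext => n; rewrite natrX.
(* The threshold [#|W|] is that of the lower bound; it also gives the [0 < n] of the upper bound. *)
apply: (@bigTheta_natr R _ _ _ _ #|W|) => n ltn.
  exact: expn_leq_max_copies.
by apply: max_copies_leq; apply: leq_ltn_trans ltn.
Qed.
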